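(* Let $X=\mathbb{Z}[\frac12]\cap(0,1)$ with the action of Thompson's group $F$ and root $p=\frac58$. Let $\varphi:X\to\mathbb{R}$ be a positive superharmonic function (with respect to the uniform measure on $\{a,a^{-1},b,b^{-1}\}$) such that $\varphi(q)\le\varphi(p)$ for all $q\in X$, and let $f$ be its min-function. Then there is a sequence $E_n\in\mathcal{P}_f(X)$, $n\in\mathbb{N}$, such that for any $g\in\mathcal{P}_f(X)\rtimes F$ the sequence $\frac{f(gE_n)}{f(E_n)}$ converges to $1$.
   Context: Thompson's group $F$ is the group of orientation-preserving piecewise linear homeomorphisms of $[0,1]$ with finitely many breakpoints, all dyadic rationals, and all slopes integer powers of $2$; it acts on $X=\mathbb{Z}[\frac12]\cap(0,1)$. It is generated by $a$ and $b$, where $a(x)=2x$ on $[0,\frac14]$, $a(x)=\frac x2+\frac38$ on $[\frac14,\frac34]$, $a(x)=x$ on $[\frac34,1]$; and $b(x)=x$ on $[0,\frac12]$, $b(x)=\frac x2+\frac14$ on $[\frac12,\frac34]$, $b(x)=x-\frac18$ on $[\frac34,\frac78]$, $b(x)=2x-1$ on $[\frac78,1]$. Root: $p=\frac58$. A function $\varphi:X\to\mathbb{R}$ is superharmonic if $\varphi(x)\ge\frac14(\varphi(ax)+\varphi(bx)+\varphi(a^{-1}x)+\varphi(b^{-1}x))$ for all $x\in X$. $\mathcal{P}_f(X)$ is the set of finite subsets of $X$. The lamplighter group $\mathcal{P}_f(X)\rtimes F$ has multiplication $(E,g)(E',h)=(E\,\Delta\,gE',gh)$ and acts on $\mathcal{P}_f(X)$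 by $(E,g)(E')=E\,\Delta\,gE'$. The min-function of $\varphi$ is $f:\mathcal{P}_f(X)\to\mathbb{R}$, $f(E)=\min_{x\in E}\varphi(x)$ for $E\ne\varnothing$, $f(\varnothing)=\varphi(p)$. *)

(* Defs.v *)
From HB Require Import structures.
From mathcomp Require Import all_boot all_order all_algebra finmap.
From mathcomp Require Import all_classical all_reals all_analysis.
From mathcomp Require Import ring lra.

Set Implicit Arguments.
Unset Strict Implicit.
Unset Printing Implicit Defensive.

Import Order.TTheory GRing.Theory Num.Theory.
Import numFieldNormedType.Exports.

Local Open Scope classical_set_scope.
Local Open Scope ring_scope.

Definition dyadic (R : realType) (x : R) : Prop :=
  exists (m : int) (n : nat), x = m%:~R / 2 ^+ n.

Definition homeo01 (R : realType) (h : R -> R) : Prop :=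
  exists k : R -> R,
    [/\ set_fun `[0, 1] `[0, 1] h, set_fun `[0, 1] `[0, 1] k,
        {in `[0, 1], cancel h k} /\ {in `[0, 1], cancel k h},
        {within `[0, 1], continuous h} & {within `[0, 1], continuous k}].

(* [B] contains the breakpoints: on a subinterval of [0, 1] whose interior    *)
(* misses [B] there is a single affine piece.                                 *)
Definition dyadic_pl01 (R : realType) (h : R -> R) : Prop :=
  exists B : seq R,
    (forall t, t \in B -> dyadic t) /\
    (forall u v : R, 0 <= u -> u < v -> v <= 1 ->
       (forall t, t \in B -> ~~ (u < t < v)) ->
       exists (k : int) (c : R),
         forall x, u <= x <= v -> h x = 2 ^ k * x + c).

(* A homeomorphism of [0, 1] is represented by its extension to the whole     *)
(* line by the identity, so that equality of functions on [0, 1] is Leibniz   *)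
(* equality.                                                                  *)
Definition in_thompson (R : realType) (h : R -> R) : Prop :=
  [/\ forall x, ~~ (0 <= x <= 1) -> h x = x,
      homeo01 h,
      {in `[0, 1] &, {homo h : x y / x < y}}
    & dyadic_pl01 h].

Section Dyadic.
Variable R : realType.
Implicit Types (x y : R).

Lemma dyadicD x y : dyadic x -> dyadic y -> dyadic (x + y).
Proof.
move=> [m [n ->]] [m' [n' ->]].
exists (m * 2 ^+ n' + m' * 2 ^+ n), (n + n')%N.
rewrite rmorphD !rmorphM !rmorphXn /= exprD.
have nz k : (2 : R) ^+ k != 0 by rewrite expf_neq0 // pnatr_eq0.
by field; rewrite !nz.
Qed.

Lemma dyadicN x : dyadic x -> dyadic (- x).
Proof. by move=> [m [n ->]]; exists (- m), n; rewrite rmorphN mulNr. Qed.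

Lemma dyadicB x y : dyadic x -> dyadic y -> dyadic (x - y).
Proof. by move=> dx dy; apply: dyadicD => //; apply: dyadicN. Qed.

Lemma dyadicZ (k : int) x : dyadic x -> dyadic (2 ^ k * x).
Proof.
move=> [m [n ->]]; case: k => k.
- exists (2 ^+ k * m), n.
  by rewrite rmorphM rmorphXn /= -exprnP mulrA.
- exists m, (k.+1 + n)%N.
  rewrite NegzE -exprnN exprD invfM; ring.
Qed.

Lemma dyadic0 : dyadic (0 : R).
Proof. by exists 0, 0%N; rewrite mul0r. Qed.

Lemma dyadic_frac (m : int) (n : nat) : dyadic (m%:~R / 2 ^+ n : R).
Proof. by exists m, n. Qed.

End Dyadic.

Section InThompson.
Variable R : realType.
Implicit Types (h k g : R -> R).

Lemma in_thompson_homo h : in_thompson h -> {homo h : x y / x < y}.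
Proof.
move=> [hid [k [hI _ _ _ _]] hlt _] x y xy.
have hI' z : 0 <= z <= 1 -> 0 <= h z <= 1.
  by move=> zI; have := hI z; rewrite /= !in_itv /= => /(_ zI).
case: (boolP (0 <= x <= 1)) => xI; case: (boolP (0 <= y <= 1)) => yI.
- by apply: hlt; rewrite ?in_itv.
- rewrite (hid y yI); have := hI' x xI; move: xI yI; lra.
- rewrite (hid x xI); have := hI' y yI; move: xI yI; lra.
- by rewrite (hid x xI) (hid y yI).
Qed.

Lemma in_thompson_mono h : in_thompson h -> {mono h : x y / x <= y}.
Proof. by move=> hF; apply: le_mono; apply: in_thompson_homo. Qed.

Lemma in_thompson_inv_fun h : in_thompson h ->
  exists k, [/\ cancel h k, cancel k h,
    forall x, ~~ (0 <= x <= 1) -> k x = x & set_fun `[0, 1] `[0, 1] k].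
Proof.
move=> [hid [k [hI kI [hk kh] _ _]] _ _].
have hI' z : 0 <= z <= 1 -> 0 <= h z <= 1.
  by move=> zI; have := hI z; rewrite /= !in_itv /= => /(_ zI).
have kI' z : 0 <= z <= 1 -> 0 <= k z <= 1.
  by move=> zI; have := kI z; rewrite /= !in_itv /= => /(_ zI).
exists (fun x => if 0 <= x <= 1 then k x else x); split=> x /=.
- case: ifP => [|/negP hx].
    case: (boolP (0 <= x <= 1)) => xI; first by move=> _; rewrite hk // in_itv.
    by rewrite hid // => /idPn; rewrite xI.
  by case: (boolP (0 <= x <= 1)) => xI; [case: hx; apply: hI'|rewrite hid].
- by case: ifP => [xI|/negbT xI]; [rewrite kh // in_itv|rewrite hid].
- by move=> /negbTE ->.
- by rewrite in_itv /= => xI; rewrite xI in_itv /=; apply: kI'.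
Qed.

(* Continuity, in both directions, follows from monotonicity and bijectivity. *)
Lemma in_thompson_intro h k :
  (forall x, ~~ (0 <= x <= 1) -> h x = x) ->
  set_fun `[0, 1] `[0, 1] h -> set_fun `[0, 1] `[0, 1] k ->
  {in `[0, 1], cancel h k} -> {in `[0, 1], cancel k h} ->
  {in `[0, 1] &, {homo h : x y / x < y}} -> dyadic_pl01 h -> in_thompson h.
Proof.
have cont f f' : set_fun `[0, 1] `[0, 1] f -> set_fun `[0, 1] `[0, 1] f' ->
    {in `[0, 1], cancel f f'} -> {in `[0, 1], cancel f' f} ->
    {in `[0, 1] &, {homo f : x y / x < y}} ->
    {within `[0, 1], continuous (f : R -> R)}.
  move=> fI f'I ff' f'f flt.
  have fle : {in `[0, 1] &, {mono f : x y / x <= y}} by apply: le_mono_in.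
  apply: segment_inc_surj_continuous => // y.
  rewrite /= in_itv /= => yI.
  have I0 : (0 : R) \in `[0, 1] by rewrite in_itv /= lexx ler01.
  have I1 : (1 : R) \in `[0, 1] by rewrite in_itv /= lexx ler01.
  have yI' : y \in `[0, 1].
    move: (fI 0 I0) (fI 1 I1); rewrite /= !in_itv /=; move: yI; lra.
  exists (f' y); last exact: f'f.
  exact: f'I.
move=> hid hI kI hk kh hlt hpl; split=> //; exists k; split=> //.
  exact: (cont h k).
apply: (cont k h) => //.
have hle : {in `[0, 1] &, {mono h : x y / x <= y}} by apply: le_mono_in.
move=> x y xI yI xy.
have := leW_mono_in hle; move=> /(_ (k x) (k y)) <-; [|exact: kI..].
by rewrite !kh.
Qed.

Lemma in_thompson_0 h : in_thompson h -> h 0 = 0.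
Proof.
move=> hF; have [k [hk kh _ kI]] := in_thompson_inv_fun hF.
have [_ [_ [hI _ _ _ _]] _ _] := hF.
have I0 : (0 : R) \in `[0, 1] by rewrite in_itv /= lexx ler01.
apply/eqP; rewrite eq_le; apply/andP; split; last first.
  by have := hI 0 I0; rewrite /= in_itv /= => /andP[].
rewrite -{2}(kh 0) (in_thompson_mono hF).
by have := kI 0 I0; rewrite /= in_itv /= => /andP[].
Qed.

Lemma in_thompson_dyadic h x : in_thompson h -> dyadic x -> dyadic (h x).
Proof.
move=> hF; have h0 := in_thompson_0 hF; have [hid _ _ [B [dB plB]]] := hF.
have [n] := ubnP (size [seq t <- B | 0 < t < x]).
elim: n x => // n IH x szx dx.
case: (boolP (0 <= x <= 1)) => [/andP[x0 x1]|xI]; last by rewrite hid.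
move: x0; rewrite le_eqVlt => /orP[/eqP<-|x0]; first by rewrite h0; apply: dyadic0.
have step t : 0 <= t -> t < x -> dyadic t -> dyadic (h t) ->
    (forall s, s \in B -> ~~ (t < s < x)) -> dyadic (h x).
  move=> t0 tx dt dht noB.
  have [k [c aff]] := plB t x t0 tx x1 noB.
  have -> : h x = h t + 2 ^ k * (x - t).
    by rewrite (aff x) ?(aff t) ?lexx ?(ltW tx) //; ring.
  by apply: dyadicD => //; apply: dyadicZ; apply: dyadicB.
have [/eqP noB|neB] := eqVneq [seq t <- B | 0 < t < x] [::].
  apply: (step 0) => //; first exact: dyadic0.
    by rewrite h0; apply: dyadic0.
  move=> s sB; apply/negP => sx.
  have : s \in [seq t <- B | 0 < t < x] by rewrite mem_filter sx.
  by rewrite (eqP noB).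
set C := [seq t <- B | 0 < t < x] in szx neB.
pose t := \big[Order.max/0]_(s <- C) s.
have tC : t \in C.
  rewrite /t; have : all (fun s => 0 < s) C.
    by apply/allP => s; rewrite mem_filter => /andP[/andP[]].
  elim: (C) neB => // s [|s' l] IHl _ /= /andP[s0 al].
    by rewrite big_cons big_nil max_l ?ltW // inE.
  rewrite big_cons; move: IHl => /(_ isT al) IHl.
  by case: leP => _; rewrite inE ?eqxx // IHl orbT.
have maxt s : s \in C -> s <= t by move=> sC; rewrite /t; apply: le_bigmax_seq.
move: (tC); rewrite mem_filter => /andP[/andP[t0 tx] tB].
apply: (step t) => //; [exact: ltW|exact: dB| |].
- apply: IH; last exact: dB.
  rewrite -ltnS; apply: leq_trans szx; rewrite ltnS.
  have -> : [seq s <- B | 0 < s < t] = [seq s <- C | s < t].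
    rewrite -filter_predI; apply: eq_filter => s /=.
    by case: (ltP s t) => st; rewrite ?andbF //= (lt_trans st tx) !andbT.
  rewrite size_filter ltn_neqAle count_size andbT -all_count.
  by apply/negP => /allP /(_ t tC); rewrite ltxx.
- move=> s sB; apply/negP => /andP[ts sx].
  have : s \in C by rewrite mem_filter sB sx (lt_trans t0 ts).
  by move/maxt; rewrite leNgt ts.
Qed.

Lemma in_thompson_inv h k : in_thompson h -> cancel h k -> cancel k h ->
  in_thompson k.
Proof.
move=> hF hk kh.
have [k' [hk' kh' k'id k'I]] := in_thompson_inv_fun hF.
have ek : k = k' by apply: funext => x; rewrite -[x]kh hk hk'.
have hd x : dyadic x -> dyadic (h x) := in_thompson_dyadic hF.
have hmono := in_thompson_mono hF; have hlt := leW_mono hmono.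
have [hid [_ [hI _ _ _ _]] _ [B [dB plB]]] := hF.
have h0 := in_thompson_0 hF.
apply: (@in_thompson_intro _ h) => //.
- by move=> x; rewrite ek; apply: k'id.
- by rewrite ek.
- by move=> x y _ _ xy; rewrite -hlt !kh.
exists [seq h t | t <- B]; split; first by move=> t /mapP[s /dB ds ->]; apply: hd.
move=> u v u0 uv v1 noB.
have kuv : k u < k v by rewrite -hlt !kh.
have k0 x : 0 <= x -> 0 <= k x by move=> x0; rewrite -hmono kh h0.
have k1 x : x <= 1 -> k x <= 1.
  rewrite leNgt => x1; rewrite leNgt; apply: contra x1 => kx.
  have : ~~ (0 <= k x <= 1) by rewrite negb_and -!ltNge kx orbT.
  by move/hid; rewrite kh => ->.
have [|m [c aff]] := plB (k u) (k v) (k0 u u0) kuv (k1 v v1).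
  move=> t tB; have := noB (h t) (map_f h tB).
  by rewrite -[X in X < h t < _]kh -[X in _ < h t < X]kh !hlt.
exists (- m), (- (2 ^ (- m) * c)) => x /andP[ux xv].
have nz : (2 : R) ^ m != 0 by rewrite expfz_neq0.
have ex : x = 2 ^ m * k x + c.
  by rewrite -aff ?kh //; apply/andP; split; rewrite -hmono !kh.
by rewrite {2}ex -invr_expz; field.
Qed.

Lemma in_thompson_comp g h :
  in_thompson g -> in_thompson h -> in_thompson (g \o h).
Proof.
move=> gF hF.
have [kg [gk kg' kgid kgI]] := in_thompson_inv_fun gF.
have [kh [hk kh' khid khI]] := in_thompson_inv_fun hF.
have khd x : dyadic x -> dyadic (kh x) :=
  in_thompson_dyadic (in_thompson_inv hF hk kh').
have [gid [_ [gI _ _ _ _]] _ [Bg [dBg plg]]] := gF.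
have [hid [_ [hI _ _ _ _]] _ [Bh [dBh plh]]] := hF.
have hmono := in_thompson_mono hF; have hlt := leW_mono hmono.
apply: (@in_thompson_intro _ (kh \o kg)).
- by move=> x xI /=; rewrite hid ?gid.
- by move=> x xI; apply/gI/hI.
- by move=> x xI; apply/khI/kgI.
- by move=> x _ /=; rewrite gk hk.
- by move=> x _ /=; rewrite kh' kg'.
- by move=> x y _ _ xy /=; apply: in_thompson_homo => //; rewrite hlt.
exists (Bh ++ [seq kh t | t <- Bg]); split.
  by move=> t; rewrite mem_cat => /orP[/dBh //|/mapP[s /dBg sB ->]]; apply: khd.
move=> u v u0 uv v1 noB.
have [|m [c affh]] := plh u v u0 uv v1.
  by move=> t tB; apply: noB; rewrite mem_cat tB.
have hI' z : 0 <= z <= 1 -> 0 <= h z <= 1.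
  by move=> zI; have := hI z; rewrite /= !in_itv /= => /(_ zI).
have hu0 : 0 <= h u.
  by have /andP[] := hI' u (introT andP (conj u0 (ltW (lt_le_trans uv v1)))).
have hv1 : h v <= 1.
  by have /andP[] := hI' v (introT andP (conj (ltW (le_lt_trans u0 uv)) v1)).
have huv : h u < h v by rewrite hlt.
have [|m' [c' affg]] := plg (h u) (h v) hu0 huv hv1.
  move=> t tB; have : kh t \in Bh ++ [seq kh t | t <- Bg].
    by rewrite mem_cat map_f ?orbT.
  by move/noB; rewrite -hlt -[X in _ && X]hlt kh'.
exists (m' + m), (2 ^ m' * c + c') => x /andP[ux xv] /=.
rewrite affg ?hmono ?ux // affh ?ux // expfzDr ?pnatr_eq0 //; ring.
Qed.

Lemma in_thompson_id : in_thompson (@id R).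
Proof.
apply: (@in_thompson_intro _ id) => //.
exists [::]; split=> // u v _ _ _ _; exists 0, 0 => x _.
by rewrite expr0z mul1r addr0.
Qed.

End InThompson.

Record thompson (R : realType) := Thompson {
  thompson_fun :> R -> R;
  thompson_subproof : `[< in_thompson thompson_fun >] }.

HB.instance Definition _ (R : realType) :=
  [isSub for @thompson_fun R].
HB.instance Definition _ (R : realType) := [Choice of thompson R by <:].

Section ThompsonGroup.
Variable R : realType.
Implicit Types g h : thompson R.

Lemma thompsonP h : in_thompson h.
Proof. exact/asboolP/thompson_subproof. Qed.

Lemma thompson_eqP g h : (forall x, g x = h x) -> g = h.
Proof. by move=> gh; apply/val_inj/funext. Qed.

Definition thompson_one : thompson R :=
  Thompson (asboolT (in_thompson_id R)).

Definition thompson_mul g h : thompson R :=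
  Thompson (asboolT (in_thompson_comp (thompsonP g) (thompsonP h))).

Lemma thompson_inv_ex h :
  exists k : thompson R, cancel h k /\ cancel k h.
Proof.
have [k [hk kh _ _]] := in_thompson_inv_fun (thompsonP h).
by exists (Thompson (asboolT (in_thompson_inv (thompsonP h) hk kh))).
Qed.

Definition thompson_inv h : thompson R := sval (cid (thompson_inv_ex h)).

Lemma thompson_invK h : cancel h (thompson_inv h).
Proof. by rewrite /thompson_inv; case: cid => k []. Qed.

Lemma thompson_Kinv h : cancel (thompson_inv h) h.
Proof. by rewrite /thompson_inv; case: cid => k []. Qed.

Fact thompson_mulA : associative thompson_mul.
Proof. by move=> f g h; apply: thompson_eqP. Qed.

Fact thompson_mul1 : left_id thompson_one thompson_mul.
Proof. by move=> h; apply: thompson_eqP. Qed.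

Fact thompson_mulr1 : right_id thompson_one thompson_mul.
Proof. by move=> h; apply: thompson_eqP. Qed.

Fact thompson_mulV : left_inverse thompson_one thompson_inv thompson_mul.
Proof. by move=> h; apply: thompson_eqP => x /=; rewrite thompson_invK. Qed.

Fact thompson_mulrV : right_inverse thompson_one thompson_inv thompson_mul.
Proof. by move=> h; apply: thompson_eqP => x /=; rewrite thompson_Kinv. Qed.

HB.instance Definition _ := isGroup.Build (thompson R)
  thompson_mulA thompson_mul1 thompson_mulr1 thompson_mulV thompson_mulrV.

End ThompsonGroup.

Section Generators.
Variable R : realType.

Definition gen_a_fun (x : R) : R :=
  if x < 0 then x
  else if x <= 1 / 4 then 2 * x
  else if x <= 3 / 4 then x / 2 + 3 / 8
  else x.

Definition gen_b_fun (x : R) : R :=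
  if x <= 1 / 2 then x
  else if x <= 3 / 4 then x / 2 + 1 / 4
  else if x <= 7 / 8 then x - 1 / 8
  else if x <= 1 then 2 * x - 1
  else x.

Let gen_a_inv (y : R) : R :=
  if y < 0 then y
  else if y <= 1 / 2 then y / 2
  else if y <= 3 / 4 then 2 * y - 3 / 4
  else y.

Let gen_b_inv (y : R) : R :=
  if y <= 1 / 2 then y
  else if y <= 5 / 8 then 2 * y - 1 / 2
  else if y <= 3 / 4 then y + 1 / 8
  else if y <= 1 then y / 2 + 1 / 2
  else y.

Let dyadic_ratio (m n : nat) : dyadic (m%:R / (2 ^+ n) : R).
Proof. by have := @dyadic_frac R m n. Qed.

Let leVlt (x y : R) : (x <= y) || (y < x).
Proof. by case: leP. Qed.

Let two_expz1 : (2 : R) ^ (1 : int) = 2.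
Proof. by rewrite expr1z. Qed.

Let two_expz0 : (2 : R) ^ (0 : int) = 1.
Proof. by rewrite expr0z. Qed.

Let two_expzN1 : (2 : R) ^ (-1 : int) = 1 / 2.
Proof. by rewrite exprN1 mul1r. Qed.

Lemma gen_aE x :
  (x < 0 /\ gen_a_fun x = x)
  \/ (0 <= x <= 1 / 4 /\ gen_a_fun x = 2 * x)
  \/ (1 / 4 < x <= 3 / 4 /\ gen_a_fun x = x / 2 + 3 / 8)
  \/ (3 / 4 < x /\ gen_a_fun x = x).
Proof.
rewrite /gen_a_fun.
case: (ltP x 0) => h0.
  by left; split; rewrite // ?h0.
case: (leP x (1 / 4)) => h1.
  by right; left; split; rewrite // ?h0.
case: (leP x (3 / 4)) => h2.
  by do 2 right; left; split; rewrite // ?h1.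
by do 3 right.
Qed.

Let gen_a_invE x :
  (x < 0 /\ gen_a_inv x = x)
  \/ (0 <= x <= 1 / 2 /\ gen_a_inv x = x / 2)
  \/ (1 / 2 < x <= 3 / 4 /\ gen_a_inv x = 2 * x - 3 / 4)
  \/ (3 / 4 < x /\ gen_a_inv x = x).
Proof.
rewrite /gen_a_inv.
case: (ltP x 0) => h0.
  by left; split; rewrite // ?h0.
case: (leP x (1 / 2)) => h1.
  by right; left; split; rewrite // ?h0.
case: (leP x (3 / 4)) => h2.
  by do 2 right; left; split; rewrite // ?h1.
by do 3 right.
Qed.

Lemma gen_bE x :
  (x <= 1 / 2 /\ gen_b_fun x = x)
  \/ (1 / 2 < x <= 3 / 4 /\ gen_b_fun x = x / 2 + 1 / 4)
  \/ (3 / 4 < x <= 7 / 8 /\ gen_b_fun x = x - 1 / 8)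
  \/ (7 / 8 < x <= 1 /\ gen_b_fun x = 2 * x - 1)
  \/ (1 < x /\ gen_b_fun x = x).
Proof.
rewrite /gen_b_fun.
case: (leP x (1 / 2)) => h0.
  by left; split; rewrite // ?h0.
case: (leP x (3 / 4)) => h1.
  by right; left; split; rewrite // ?h0.
case: (leP x (7 / 8)) => h2.
  by do 2 right; left; split; rewrite // ?h1.
case: (leP x (1)) => h3.
  by do 3 right; left; split; rewrite // ?h2.
by do 4 right.
Qed.

Let gen_b_invE x :
  (x <= 1 / 2 /\ gen_b_inv x = x)
  \/ (1 / 2 < x <= 5 / 8 /\ gen_b_inv x = 2 * x - 1 / 2)
  \/ (5 / 8 < x <= 3 / 4 /\ gen_b_inv x = x + 1 / 8)
  \/ (3 / 4 < x <= 1 /\ gen_b_inv x = x / 2 + 1 / 2)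
  \/ (1 < x /\ gen_b_inv x = x).
Proof.
rewrite /gen_b_inv.
case: (leP x (1 / 2)) => h0.
  by left; split; rewrite // ?h0.
case: (leP x (5 / 8)) => h1.
  by right; left; split; rewrite // ?h0.
case: (leP x (3 / 4)) => h2.
  by do 2 right; left; split; rewrite // ?h1.
case: (leP x (1)) => h3.
  by do 3 right; left; split; rewrite // ?h2.
by do 4 right.
Qed.

Lemma in_thompson_a : in_thompson gen_a_fun.
Proof.
apply: (@in_thompson_intro _ _ gen_a_inv).
- by move=> x; case: (gen_aE x) => [[hx ->]|[[hx ->]|[[hx ->]|[hx ->]]]]; lra.
- by move=> x; rewrite /= !in_itv /=; case: (gen_aE x) => [[hx ->]|[[hx ->]|[[hx ->]|[hx ->]]]]; lra.
- by move=> x; rewrite /= !in_itv /=; case: (gen_a_invE x) => [[hx ->]|[[hx ->]|[[hx ->]|[hx ->]]]]; lra.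
- move=> x _; have := gen_a_invE (gen_a_fun x).
  by case: (gen_aE x) => [[hx ->]|[[hx ->]|[[hx ->]|[hx ->]]]]; lra.
- move=> x _; have := gen_aE (gen_a_inv x).
  by case: (gen_a_invE x) => [[hx ->]|[[hx ->]|[[hx ->]|[hx ->]]]]; lra.
- move=> x y _ _; have := gen_aE y.
  by case: (gen_aE x) => [[hx ->]|[[hx ->]|[[hx ->]|[hx ->]]]]; lra.
exists [:: 1 / 4; 3 / 4]; split.
  move=> t; rewrite !inE => /orP[] /eqP ->.
    by have := dyadic_ratio 1 2; rewrite expr2 -natrM.
  by have := dyadic_ratio 3 2; rewrite expr2 -natrM.
move=> u v u0 uv v1 noB.
have n1 := noB (1 / 4) (mem_head _ _).
have n2 : ~~ (u < 3 / 4 < v) by apply: noB; rewrite !inE eqxx orbT.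
have /orP[v4|v4] := leVlt v (1 / 4).
  by exists 1, 0 => x; rewrite two_expz1; case: (gen_aE x) => [[hx ->]|[[hx ->]|[[hx ->]|[hx ->]]]]; lra.
have /orP[v3|v3] := leVlt v (3 / 4).
  by exists (-1), (3 / 8) => x; rewrite two_expzN1; case: (gen_aE x) => [[hx ->]|[[hx ->]|[[hx ->]|[hx ->]]]]; lra.
by exists 0, 0 => x; rewrite two_expz0; case: (gen_aE x) => [[hx ->]|[[hx ->]|[[hx ->]|[hx ->]]]]; lra.
Qed.

Lemma in_thompson_b : in_thompson gen_b_fun.
Proof.
apply: (@in_thompson_intro _ _ gen_b_inv).
- by move=> x; case: (gen_bE x) => [[hx ->]|[[hx ->]|[[hx ->]|[[hx ->]|[hx ->]]]]]; lra.
- by move=> x; rewrite /= !in_itv /=; case: (gen_bE x) => [[hx ->]|[[hx ->]|[[hx ->]|[[hx ->]|[hx ->]]]]]; lra.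
- by move=> x; rewrite /= !in_itv /=; case: (gen_b_invE x) => [[hx ->]|[[hx ->]|[[hx ->]|[[hx ->]|[hx ->]]]]]; lra.
- move=> x _; have := gen_b_invE (gen_b_fun x).
  by case: (gen_bE x) => [[hx ->]|[[hx ->]|[[hx ->]|[[hx ->]|[hx ->]]]]]; lra.
- move=> x _; have := gen_bE (gen_b_inv x).
  by case: (gen_b_invE x) => [[hx ->]|[[hx ->]|[[hx ->]|[[hx ->]|[hx ->]]]]]; lra.
- move=> x y _ _; have := gen_bE y.
  by case: (gen_bE x) => [[hx ->]|[[hx ->]|[[hx ->]|[[hx ->]|[hx ->]]]]]; lra.
exists [:: 1 / 2; 3 / 4; 7 / 8]; split.
  move=> t; rewrite !inE => /or3P[] /eqP ->.
  - by have := dyadic_ratio 1 1; rewrite expr1.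
  - by have := dyadic_ratio 3 2; rewrite expr2 -natrM.
  - by have := dyadic_ratio 7 3; rewrite -natrX.
move=> u v u0 uv v1 noB.
have n1 := noB (1 / 2) (mem_head _ _).
have n2 : ~~ (u < 3 / 4 < v) by apply: noB; rewrite !inE eqxx orbT.
have n3 : ~~ (u < 7 / 8 < v) by apply: noB; rewrite !inE eqxx !orbT.
have /orP[v2|v2] := leVlt v (1 / 2).
  by exists 0, 0 => x; rewrite two_expz0; case: (gen_bE x) => [[hx ->]|[[hx ->]|[[hx ->]|[[hx ->]|[hx ->]]]]]; lra.
have /orP[v3|v3] := leVlt v (3 / 4).
  by exists (-1), (1 / 4) => x; rewrite two_expzN1; case: (gen_bE x) => [[hx ->]|[[hx ->]|[[hx ->]|[[hx ->]|[hx ->]]]]]; lra.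
have /orP[v7|v7] := leVlt v (7 / 8).
  by exists 0, (- (1 / 8)) => x; rewrite two_expz0; case: (gen_bE x) => [[hx ->]|[[hx ->]|[[hx ->]|[[hx ->]|[hx ->]]]]]; lra.
by exists 1, (-1) => x; rewrite two_expz1; case: (gen_bE x) => [[hx ->]|[[hx ->]|[[hx ->]|[[hx ->]|[hx ->]]]]]; lra.
Qed.

Definition gen_a : thompson R := Thompson (asboolT in_thompson_a).
Definition gen_b : thompson R := Thompson (asboolT in_thompson_b).

End Generators.

Record dyadic01 (R : realType) := Dyadic01 {
  dyadic01_val :> R;
  dyadic01_subproof : `[< dyadic dyadic01_val >] && (0 < dyadic01_val < 1) }.

HB.instance Definition _ (R : realType) := [isSub for @dyadic01_val R].
HB.instance Definition _ (R : realType) := [Choice of dyadic01 R by <:].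

Section Action.
Variable R : realType.
Local Notation X := (dyadic01 R).
Local Notation F := (thompson R).
Implicit Types (x : X) (g h : F) (E : {fset X}).

Fact root_subproof : `[< dyadic (5 / 8 : R) >] && (0 < (5 / 8 : R) < 1).
Proof.
apply/andP; split; last by lra.
by apply/asboolP; have := @dyadic_frac R 5 3; rewrite -natrX.
Qed.

Definition root_p : X := Dyadic01 root_subproof.

Fact thompson_act_subproof g x :
  `[< dyadic (g x) >] && (0 < g x < 1).
Proof.
case: x => x /= /andP[/asboolP dx /andP[x0 x1]].
have gF := thompsonP g; apply/andP; split.
  exact/asboolP/in_thompson_dyadic.
have [_ [_ [gI _ _ _ _]] _ _] := gF.
have I1 : (1 : R) \in `[0, 1] by rewrite in_itv /= lexx ler01.
have := gI 1 I1; rewrite /= in_itv /= => /andP[_ g1].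
rewrite -[X in X < _](in_thompson_0 gF) (in_thompson_homo gF x0) /=.
exact: lt_le_trans (in_thompson_homo gF x1) g1.
Qed.

Definition thompson_act g x : X := Dyadic01 (thompson_act_subproof g x).

Lemma thompson_act1 x : thompson_act 1%g x = x.
Proof. exact: val_inj. Qed.

Lemma thompson_actM g h x :
  thompson_act (g * h)%g x = thompson_act g (thompson_act h x).
Proof. exact: val_inj. Qed.

Definition fset_act g E : {fset X} := [fset thompson_act g x | x in E]%fset.

Definition fsymdiff E E' : {fset X} := ((E `\` E') `|` (E' `\` E))%fset.

Lemma in_fsymdiff x E E' : (x \in fsymdiff E E') = (x \in E) (+) (x \in E').
Proof. by rewrite !inE; do 2 case: (_ \in _). Qed.

Lemma in_fset_act g x E :
  (x \in fset_act g E) = (thompson_act g^-1%g x \in E).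
Proof.
apply/imfsetP/idP => [[y /= yE ->]|xE].
  by rewrite -thompson_actM mulVg thompson_act1.
by exists (thompson_act g^-1%g x) => //; rewrite -thompson_actM mulgV thompson_act1.
Qed.

Definition lamplighter : Type := ({fset X} * F)%type.

Definition lamplighter_mul (u v : lamplighter) : lamplighter :=
  (fsymdiff u.1 (fset_act u.2 v.1), (u.2 * v.2)%g).

Definition lamplighter_one : lamplighter := (fset0, 1%g).

Definition lamplighter_inv (u : lamplighter) : lamplighter :=
  (fset_act u.2^-1%g u.1, u.2^-1%g).

Definition lamplighter_act (u : lamplighter) E : {fset X} :=
  fsymdiff u.1 (fset_act u.2 E).

Fact lamplighter_mulA : associative lamplighter_mul.
Proof.
move=> [E f] [E' g] [E'' h]; congr pair; last by rewrite /= mulgA.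
apply/fsetP => x /=.
by rewrite !(in_fsymdiff, in_fset_act) invgM thompson_actM addbA.
Qed.

Fact lamplighter_mul1 : left_id lamplighter_one lamplighter_mul.
Proof.
move=> [E g]; congr pair; last by rewrite /= mul1g.
by apply/fsetP => x; rewrite !(in_fsymdiff, in_fset_act) inE invg1 thompson_act1.
Qed.

Fact lamplighter_mulr1 : right_id lamplighter_one lamplighter_mul.
Proof.
move=> [E g]; congr pair; last by rewrite /= mulg1.
by apply/fsetP => x; rewrite !(in_fsymdiff, in_fset_act) inE addbF.
Qed.

Fact lamplighter_mulV :
  left_inverse lamplighter_one lamplighter_inv lamplighter_mul.
Proof.
move=> [E g]; congr pair; last by rewrite /= mulVg.
by apply/fsetP => x; rewrite !(in_fsymdiff, in_fset_act) inE addbb.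
Qed.

Fact lamplighter_mulrV :
  right_inverse lamplighter_one lamplighter_inv lamplighter_mul.
Proof.
move=> [E g]; congr pair; last by rewrite /= mulgV.
apply/fsetP => x; rewrite !(in_fsymdiff, in_fset_act) invgK inE.
by rewrite -thompson_actM mulgV thompson_act1 addbb.
Qed.

HB.instance Definition _ := Choice.on lamplighter.
HB.instance Definition _ := isGroup.Build lamplighter
  lamplighter_mulA lamplighter_mul1 lamplighter_mulr1
  lamplighter_mulV lamplighter_mulrV.

Lemma lamplighter_actM (u v : lamplighter) E :
  lamplighter_act (u * v)%g E = lamplighter_act u (lamplighter_act v E).
Proof.
by have [] := lamplighter_mulA u v (E, 1%g).
Qed.

Lemma lamplighter_act1 E : lamplighter_act 1%g E = E.
Proof. by have [] := lamplighter_mul1 (E, 1%g). Qed.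

Definition superharmonic (phi : X -> R) : Prop :=
  forall x, phi x >= 1 / 4 *
    (phi (thompson_act (gen_a R) x) + phi (thompson_act (gen_b R) x)
     + phi (thompson_act (gen_a R)^-1%g x) + phi (thompson_act (gen_b R)^-1%g x)).

(* The seed of the iterated minimum is the value at some element of [E] when  *)
(* [E] is nonempty, so it does not affect the result.                         *)
Definition min_function (phi : X -> R) (E : {fset X}) : R :=
  if E == fset0 then phi root_p
  else \big[Order.min/phi (head root_p E)]_(x <- E) phi x.

Lemma min_functionP (phi : X -> R) (E : {fset X}) : E != fset0 ->
  (exists2 x, x \in E & min_function phi E = phi x) /\
  (forall x, x \in E -> min_function phi E <= phi x).
Proof.
move=> E0; rewrite /min_function (negbTE E0); split; last first.
  by move=> x xE; apply: bigmin_inf_seq xE _ _.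
have hE : head root_p E \in E.
  have hs (s : seq X) y : y \in s -> head root_p s \in s.
    by case: s => //= z s _; rewrite mem_head.
  by have /fset0Pn[y yE] := E0; apply: hs yE.
rewrite big_seq; elim/big_ind: _ => [|u v [x xE ->] [y yE ->]|x xE].
- by exists (head root_p E).
- by case: leP => _; [exists x|exists y].
- by exists x.
Qed.

End Action.

(* Main.v *)
Require Import Defs.
From mathcomp Require Import all_boot all_order all_algebra finmap.
From mathcomp Require Import all_classical all_reals all_analysis.
From mathcomp Require Import ring lra.
Import Order.TTheory GRing.Theory Num.Theory.
Import numFieldNormedType.Exports.
Local Open Scope classical_set_scope.
Local Open Scope ring_scope.

(* Let [m] be the infimum of [phi] and [psi = phi - m]. On a ray              *)
(* [x, x/2, x/4, ...] with [x <= 1/2] the generator [b] acts trivially and    *)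
(* [a] by doubling, so [psi] is concave, nonnegative, hence nondecreasing     *)
(* along the ray, and a shift by [i] at distance [k] changes [psi] by a       *)
(* factor within [i/k] of [1]. Every element of Thompson's group is of the    *)
(* form [t |-> 2^j t] near [0], so it acts on the far part of all rays as a   *)
(* shift. Take [E_n = {x_n}] with [x_n] the [n]-th point of a ray whose       *)
(* origin has [psi] so small that [psi x_n -> 0]. A finite set of lamps does  *)
(* not affect the limit, since [phi x_n -> m] and [(1 - e) m < phi d] for all *)
(* [d].                                                                       *)

(** The ray in this argument changes with [n]: by [superharmonic_left_half] its origin [y n] can be
    chosen in the left half with [psi (y n)] as small as desired, and by [ray_harnack] the [n.+1]
    steps along the ray cost at most a factor [4 ^+ n.+1]. So the shift that a group element induces
    must be the same on all rays, which [thompson_act_ray] provides. [concave_ge0_growth] and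
    [concave_ge0_growthN] bound the effect of a shift, and [almost_invariant_points] combines these
    facts. *)

Section ConcaveSequence.
Variables (R : realType) (c : nat -> R).
Hypothesis c_ge0 : forall k, 0 <= c k.
Hypothesis c_concave : forall k, c k + c k.+2 <= 2 * c k.+1.

Lemma concave_step_le k n : c (k + n).+1 - c (k + n)%N <= c k.+1 - c k.
Proof.
elim: n => [|n IH]; first by rewrite addn0.
by rewrite addnS; have := c_concave (k + n)%N; move: IH; lra.
Qed.

Lemma concave_le_line k n : c (k + n)%N <= c k + n%:R * (c k.+1 - c k).
Proof.
elim: n => [|n IH]; first by rewrite addn0 mul0r addr0.
rewrite addnS -natr1; have := concave_step_le k n; move: IH; lra.
Qed.

(** By concavity a negative step would bound the rest of the sequence by a descending line, which
    crosses zero. *)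
Lemma concave_ge0_ndecr k : c k <= c k.+1.
Proof.
rewrite leNgt; apply/negP => ck.
have d0 : 0 < c k - c k.+1 by lra.
have := archi_boundP (divr_ge0 (c_ge0 k) (ltW d0)).
move: (Num.bound _) => n; rewrite ltr_pdivrMr // => kn.
by have := concave_le_line k n; have := c_ge0 (k + n)%N; lra.
Qed.

Lemma concave_ge0_homo : {homo c : k n / (k <= n)%N >-> k <= n}.
Proof. exact/nondecreasing_seqP/concave_ge0_ndecr. Qed.

(** The slope [c k / k] of the chord from the origin does not increase, because [c 0] is
    nonnegative. *)
Lemma concave_ge0_succ k : k%:R * c k.+1 <= k.+1%:R * c k.
Proof.
elim: k => [|k IH]; first by rewrite mul0r mul1r.
have := ler_wpM2l (ler0n R k.+1) (c_concave k).
move: IH; rewrite -!natr1; lra.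
Qed.

Lemma concave_ge0_growth k i : (0 < k)%N ->
  k%:R * (c (k + i)%N - c k) <= i%:R * c k.
Proof.
move=> k0; have := ler_wpM2l (ler0n R k) (concave_le_line k i).
have := ler_wpM2l (ler0n R i) (concave_ge0_succ k).
rewrite -!natr1; lra.
Qed.

Lemma concave_ge0_growthN k i : (i < k)%N ->
  k%:R * (c k - c (k - i)%N) <= i%:R * c k.
Proof.
(* Adding [i * (c k - c (k - i))] to both sides of the forward bound at [k - i] gives the claim. *)
move=> ik; have := @concave_ge0_growth (k - i) i.
rewrite subn_gt0 subnK ?(ltnW ik) // natrB ?(ltnW ik) // => /(_ ik); lra.
Qed.

End ConcaveSequence.

(** * The generators and the rays towards 0 *)

Section LeftRays.
Variable R : realType.
Local Notation X := (dyadic01 R).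
Local Notation a := (thompson_act (gen_a R)).
Local Notation b := (thompson_act (gen_b R)).
Local Notation a' := (thompson_act (gen_a R)^-1%g).
Local Notation b' := (thompson_act (gen_b R)^-1%g).
Implicit Types x y z : X.

Lemma dyadic01_gt0 x : 0 < x :> R.
Proof. by case: x => x /= /andP[_ /andP[]]. Qed.

Lemma dyadic01_lt1 x : x < 1 :> R.
Proof. by case: x => x /= /andP[_ /andP[]]. Qed.

Lemma thompson_actK g : cancel (thompson_act g : X -> X) (thompson_act g^-1%g).
Proof. by move=> x; rewrite -thompson_actM mulVg thompson_act1. Qed.

Lemma thompson_actKV g : cancel (thompson_act g^-1%g : X -> X) (thompson_act g).
Proof. by move=> x; rewrite -thompson_actM mulgV thompson_act1. Qed.

Lemma thompson_act_fixV g x : thompson_act g x = x -> thompson_act g^-1%g x = x.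
Proof. by move=> gx; rewrite -[in LHS]gx thompson_actK. Qed.

Lemma thompson_inv_valE (g : thompson R) (x : R) y :
  g x = y -> thompson_act g^-1%g y = x :> R.
Proof. by move=> gx; rewrite /= -gx thompson_invK. Qed.

Lemma gen_a_invE x : x <= 1 / 2 :> R -> a' x = (x : R) / 2 :> R.
Proof.
move=> x2; apply: thompson_inv_valE => /=.
by have := dyadic01_gt0 x; have := gen_aE ((x : R) / 2); lra.
Qed.

Lemma gen_a_inv_le x : x <= 5 / 8 :> R -> a' x <= 1 / 2 :> R.
Proof.
move=> x58; have := dyadic01_gt0 (a' x).
have : gen_a_fun (a' x : R) = x by rewrite -[in RHS](thompson_actKV (gen_a R) x).
by have := gen_aE (a' x : R); lra.
Qed.

Lemma gen_b_le x : x <= 3 / 4 :> R -> b x <= 5 / 8 :> R.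
Proof. by move=> x34 /=; have := gen_bE (x : R); lra. Qed.

Lemma gen_b_fix x : x <= 1 / 2 :> R -> b x = x.
Proof. by move=> x2; apply: val_inj => /=; have := gen_bE (x : R); lra. Qed.

Lemma gen_a_fix x : 3 / 4 <= x :> R -> a x = x.
Proof. by move=> x2; apply: val_inj => /=; have := gen_aE (x : R); lra. Qed.

Lemma gen_b_inv_ge x : 3 / 4 <= x :> R -> 3 / 4 <= b' x :> R.
Proof.
move=> x34; have := dyadic01_lt1 (b' x).
have : gen_b_fun (b' x : R) = x by rewrite -[in RHS](thompson_actKV (gen_b R) x).
by have := gen_bE (b' x : R); lra.
Qed.

Definition ray x k := iter k a' x.

Lemma rayE x k : x <= 1 / 2 :> R -> ray x k = (x : R) / 2 ^+ k :> R.
Proof.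
move=> x2; elim: k => [|k IH]; first by rewrite expr0 divr1.
rewrite [ray x k.+1]/(a' (ray x k)) gen_a_invE IH.
  by rewrite exprSr invfM mulrA.
apply: le_trans x2; rewrite ler_pdivrMr ?exprn_gt0 // ler_peMr //.
  exact/ltW/dyadic01_gt0.
by apply: exprn_ege1; lra.
Qed.

Lemma ray_le x k : x <= 1 / 2 :> R -> ray x k <= 1 / 2 ^+ k :> R.
Proof.
move=> x2; rewrite rayE // ler_pM2r ?invr_gt0 ?exprn_gt0 //; lra.
Qed.

Lemma ray_le_half x k : x <= 1 / 2 :> R -> ray x k <= 1 / 2 :> R.
Proof.
case: k => [//|k] x2; apply: le_trans (ray_le x k.+1 x2) _.
rewrite exprS ler_pM2l // lef_pV2 ?posrE ?mulr_gt0 ?exprn_gt0 // ler_peMr //.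
by apply: exprn_ege1; lra.
Qed.

(** * Nonnegative superharmonic functions on rays *)

Section Superharmonic.
Variable psi : X -> R.
Hypothesis psi_ge0 : forall x, 0 <= psi x.
Hypothesis psi_super : superharmonic psi.

Lemma superharmonic_a_inv_le x : psi (a' x) <= 4 * psi x.
Proof.
have := psi_super x; have := psi_ge0 (a x); have := psi_ge0 (b x).
have := psi_ge0 (b' x); lra.
Qed.

Lemma superharmonic_b_le x : psi (b x) <= 4 * psi x.
Proof.
have := psi_super x; have := psi_ge0 (a x); have := psi_ge0 (a' x).
have := psi_ge0 (b' x); lra.
Qed.

Lemma ray_harnack x k : psi (ray x k) <= 4 ^+ k * psi x.
Proof.
elim: k => [|k IH]; first by rewrite mul1r.
rewrite exprS; have := superharmonic_a_inv_le (ray x k).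
rewrite -[a' _]/(ray x k.+1); lra.
Qed.

(** Since [b] and its inverse fix the middle point, half of the average is [psi] at that point
    itself; only the two neighbours on the ray remain. *)
Lemma ray_concave x : x <= 1 / 2 :> R -> forall k,
  psi (ray x k) + psi (ray x k.+2) <= 2 * psi (ray x k.+1).
Proof.
move=> x2 k; have := psi_super (ray x k.+1).
have bx := gen_b_fix _ (ray_le_half x k.+1 x2).
rewrite bx (thompson_act_fixV _ _ bx) {1}/ray iterS thompson_actKV.
by rewrite -/(ray x k) -[a' _]/(ray x k.+2); lra.
Qed.

(* Towards [1] the orbit of [b] is also a ray fixed by [a], along which [psi] *)
(* is concave and nonnegative, hence nondecreasing.                           *)
Lemma superharmonic_pull x : 3 / 4 <= x :> R -> psi (b x) <= psi x.
Proof.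
move=> x34; pose c k := psi (iter k b' (b x)).
have x1 : iter 1 b' (b x) = x := thompson_actK (gen_b R) x.
(* Index 0 is left out, as [b x] may lie below 3/4; concavity is only needed at the midpoints, whose
   indices are positive. *)
have ge34 k : 3 / 4 <= iter k.+1 b' (b x) :> R.
  by elim: k => [|k IH]; [rewrite x1|rewrite iterS; exact: gen_b_inv_ge].
rewrite -[in leRHS]x1 -[psi (b x)]/(c 0%N); apply: concave_ge0_ndecr => k.
  exact: psi_ge0.
rewrite /c; have := psi_super (iter k.+1 b' (b x)).
have ay := gen_a_fix _ (ge34 k).
rewrite ay (thompson_act_fixV _ _ ay) -iterS.
by rewrite [in psi (b (iter _ _ _))]iterS thompson_actKV; lra.
Qed.

(** The constant does not depend on [x]: near 1 any number of applications of [b] is free by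
    [superharmonic_pull], and from 7/8 downwards the three moves [b], [b], [a'] reach the left half,
    each costing a factor 4. *)
Lemma superharmonic_left_half x :
  exists2 y : X, y <= 1 / 2 :> R & psi y <= 64 * psi x.
Proof.
have base z : z <= 7 / 8 :> R ->
    exists2 y : X, y <= 1 / 2 :> R & psi y <= 64 * psi z.
  move=> z78; exists (a' (b (b z))).
    apply/gen_a_inv_le/gen_b_le => /=.
    by have := gen_bE (z : R); lra.
  have := superharmonic_a_inv_le (b (b z)).
  by have := superharmonic_b_le (b z); have := superharmonic_b_le z; lra.
have [n] : exists n, 1 / 8 <= 2 ^+ n * (1 - (x : R)).
  have x1 : 0 < 1 - (x : R) by have := dyadic01_lt1 x; lra.
  have [n _ /(_ n (leqnn n))] := near_infty_natSinv_expn_lt (PosNum x1).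
  rewrite /= ltr_pdivrMr ?exprn_gt0 // => h; exists n; lra.
elim: n x => [|n IH] x xn.
  by apply: base; move: xn; rewrite expr0; lra.
have [/base //|x78] := leP (x : R) (7 / 8).
have [|y y2 yx] := IH (b x).
  move: xn; rewrite exprS => xn.
  suff -> : 1 - (b x : R) = 2 * (1 - (x : R)) by lra.
  by rewrite /=; have := dyadic01_lt1 x; have := gen_bE (x : R); lra.
exists y => //; apply: le_trans yx _; rewrite ler_pM2l //.
by apply: superharmonic_pull; lra.
Qed.

End Superharmonic.

(** * Germs at 0 of elements of Thompson's group *)

Lemma thompson_near0 (h : thompson R) : exists (k : int) (d : R),
  0 < d /\ forall t : R, 0 <= t <= d -> h t = 2 ^ k * t.
Proof.
have h0 := in_thompson_0 (thompsonP h).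
have [_ _ _ [B [_ pl]]] := thompsonP h.
(* No breakpoint lies strictly between 0 and [v], and [h 0 = 0] removes the constant term. *)
pose v : R := \big[Order.min/1]_(t <- B | 0 < t) t.
have v0 : 0 < v.
  by rewrite /v; elim/big_ind: _ => // u w u0 w0; rewrite lt_min u0.
have v1 : v <= 1 by exact: bigmin_le_id.
have [|k [c aff]] := pl 0 v (lexx 0) v0 v1.
  move=> t tB; apply/negP => /andP[t0]; rewrite ltNge => /negP; apply.
  exact: bigmin_inf_seq tB t0 _.
have c0 : c = 0.
  by have := aff 0; rewrite h0 lexx (ltW v0) mulr0 add0r => /(_ isT).
by exists k, v; split=> // t tv; rewrite aff // c0 addr0.
Qed.

(** [i] and [N] are uniform in the origin [x], since the [n]-th point of every ray in the left half
    is at most [1 / 2 ^+ n]. *)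
Lemma thompson_act_ray (h : thompson R) : exists i N : nat,
  (forall n x, (N <= n)%N -> x <= 1 / 2 :> R ->
     thompson_act h (ray x n) = ray x (n + i)) \/
  (forall n x, (N <= n)%N -> x <= 1 / 2 :> R ->
     (i < n)%N /\ thompson_act h (ray x n) = ray x (n - i)).
Proof.
have [k [d [d0 hd]]] := thompson_near0 h.
have [N _ Nd] := near_infty_natSinv_expn_lt (PosNum d0).
have hray n x : (N <= n)%N -> x <= 1 / 2 :> R ->
    h (ray x n) = 2 ^ k * ((x : R) / 2 ^+ n).
  move=> Nn x2; rewrite hd ?rayE //; apply/andP; split.
    by rewrite divr_ge0 ?exprn_ge0 // ltW // dyadic01_gt0.
  by rewrite -rayE //; apply: le_trans (ray_le x n x2) (ltW (Nd n Nn)).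
have nz m : (2 : R) ^+ m != 0 by rewrite expf_neq0 // pnatr_eq0.
case: k => i in hd hray *.
- exists i, (maxn N i.+1); right => n x; rewrite geq_max => /andP[Nn ni] x2.
  split=> //; apply: val_inj; rewrite /= hray // rayE //.
  rewrite -exprnP -[in LHS](subnK (ltnW ni)) exprD.
  by field; rewrite !nz.
- exists i.+1, N; left => n x Nn x2.
  apply: val_inj; rewrite /= hray // rayE // NegzE -exprnN exprD.
  by field; rewrite !nz.
Qed.

(** * Almost invariant points, and finite sets of lamps *)

Lemma almost_invariant_points (phi : X -> R) :
  (forall x, 0 <= phi x) -> superharmonic phi ->
  exists x : nat -> X,
    [/\ forall n, x n <= 1 / 2 ^+ n.+1 :> R,
        forall n, phi (x n) <= inf (range phi) + n.+1%:R^-1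
      & forall h : thompson R, exists i : nat, \forall n \near \oo,
          n.+1%:R * `|phi (thompson_act h (x n)) - phi (x n)| <= i%:R * phi (x n)].
Proof.
move=> phi0 phi_super; set m := inf (range phi).
have m_lb : has_lbound (range phi) by exists 0 => _ [z _ <-].
have m_inf : has_inf (range phi).
  by split=> //; exists (phi (root_p R)), (root_p R).
have m_ge0 : 0 <= m.
  by apply: lb_le_inf => [|_ [z _ <-] //]; case: m_inf.
pose psi z := phi z - m.
have psi0 z : 0 <= psi z.
  by rewrite subr_ge0; apply: ge_inf => //; exists z.
have psi_super : superharmonic psi.
  by move=> z; rewrite /psi; have := phi_super z; lra.
have start n : exists2 y : X, y <= 1 / 2 :> R &
    4 ^+ n.+1 * psi y <= n.+1%:R^-1.
  (* The divisors absorb the factor 64 of the move to the left half and the factor [4 ^+ n.+1] of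
     the walk along the ray. *)
  have e0 : 0 < n.+1%:R^-1 / 4 ^+ n.+1 / 64 :> R.
    by rewrite !divr_gt0 ?exprn_gt0 ?invr_gt0.
  have [_ [z _ <-] zm] := inf_adherent e0 m_inf.
  have [y y2 yz] := superharmonic_left_half _ psi0 psi_super z.
  exists y => //; rewrite mulrC -ler_pdivlMr ?exprn_gt0 //.
  apply: le_trans yz _; move: zm; rewrite -/m /psi.
  by move: (_ / 4 ^+ _) => t; lra.
pose y n := s2val (cid2 (start n)).
have y2 n : y n <= 1 / 2 :> R by rewrite /y; case: cid2.
have ym n : 4 ^+ n.+1 * psi (y n) <= n.+1%:R^-1 by rewrite /y; case: cid2.
exists (fun n => ray (y n) n.+1); split=> [n|n|h].
- exact: ray_le.
- rewrite -lerBlDl.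
  exact: le_trans (ray_harnack _ psi0 psi_super (y n) n.+1) (ym n).
have [i [N hN]] := thompson_act_ray h; exists i.
exists N => // n Nn; cbv beta.
have Nn1 : (N <= n.+1)%N by exact: leq_trans Nn (leqnSn n).
pose c k := psi (ray (y n) k).
have c0 k : 0 <= c k by exact: psi0.
have cc : forall k, c k + c k.+2 <= 2 * c k.+1 by exact: ray_concave.
have -> : forall w, phi w - phi (ray (y n) n.+1) = psi w - c n.+1.
  by move=> w; rewrite /c /psi; lra.
(* [psi <= phi], because [m] is nonnegative. *)
apply: (@le_trans _ _ (i%:R * c n.+1)); last first.
  by rewrite ler_wpM2l // /c /psi lerBlDr lerDl.
case: hN => hN.
- rewrite hN // -/(c (n.+1 + i)%N) ger0_norm; last first.
    by rewrite subr_ge0 concave_ge0_homo // leq_addr.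
  exact: concave_ge0_growth.
- have [ni ->] := hN n.+1 (y n) Nn1 (y2 n).
  rewrite -/(c (n.+1 - i)%N) ler0_norm; last first.
    by rewrite subr_le0 concave_ge0_homo // leq_subr.
  by rewrite opprB; exact: concave_ge0_growthN.
Qed.

Lemma min_function1 (phi : X -> R) x : min_function phi [fset x]%fset = phi x.
Proof.
have x0 : [fset x]%fset != fset0 by apply/fset0Pn; exists x; rewrite inE.
by have [[z /fset1P -> ->]] := min_functionP phi x0.
Qed.

End LeftRays.

Theorem theorem11 (R : realType) (phi : dyadic01 R -> R)
    (phi_pos : forall x : dyadic01 R, 0 < phi x)
    (phi_super : superharmonic phi)
    (phi_max : forall q : dyadic01 R, phi q <= phi (root_p R)) :
  exists E : nat -> {fset (dyadic01 R)},
    forall g : lamplighter R,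
      (fun n : nat => min_function phi (lamplighter_act g (E n))
                      / min_function phi (E n)) @ \oo --> (1 : R).
Proof.
have phi0 x : 0 <= phi x by exact: ltW.
have [x [x_small x_inf x_inv]] := almost_invariant_points R phi phi0 phi_super.
exists (fun n => [fset x n]%fset) => -[D h].
apply/cvgrPdist_le => e e0.
set m := inf (range phi) in x_inf.
have m_le z : m <= phi z.
  by apply: ge_inf; [exists 0 => _ [w _ <-]|exists z].
have [i hi] := x_inv h.
have ei0 : 0 < e / i.+1%:R by rewrite divr_gt0.
(* The first bound keeps [thompson_act h (x n)] off the lamp [d], so that the symmetric difference
   does not cancel it; the second keeps the value at [d] from lowering the minimum by more than the
   factor [1 - e]. *)
have hD (d : D) : \forall n \near \oo,
    (x n < thompson_act h^-1%g (val d) :> R) /\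
    ((1 - e) * phi (x n) <= phi (val d)).
  apply: filterI.
    have d0 := dyadic01_gt0 _ (thompson_act h^-1%g (val d)).
    near=> n; apply: le_lt_trans (x_small n) _.
    apply: (@le_lt_trans _ _ (1 / 2 ^+ n)).
      rewrite !div1r lef_pV2 ?posrE ?exprn_gt0 // ler_eXn2l ?leqnSn //; lra.
    by near: n; exact: (near_infty_natSinv_expn_lt (PosNum d0)).
  have d0 : 0 < e * phi (val d) by rewrite mulr_gt0.
  have [e1|e1] := leP 1 e.
    near=> n; apply: le_trans (phi0 _).
    by rewrite mulr_le0_ge0 // subr_le0.
  near=> n.
  (* The error is compared with [phi (val d)] rather than with the infimum, which may be 0. *)
  have nd : n.+1%:R^-1 < e * phi (val d).
    by near: n; exact: (near_infty_natSinv_lt (PosNum d0)).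
  have t0 : 0 <= e * n.+1%:R^-1 by rewrite mulr_ge0 ?invr_ge0 // ltW.
  have e1' : 0 <= 1 - e by lra.
  have := ler_wpM2l e1' (le_trans (x_inf n) (lerD (m_le (val d)) (lexx _))).
  by move: nd t0; move: (n.+1%:R^-1) => t; lra.
near=> n.
have nD d : d \in D ->
    (x n < thompson_act h^-1%g d :> R) /\ ((1 - e) * phi (x n) <= phi d).
  move=> dD; rewrite -[d]/(val [` dD]%fset); move: [` dD]%fset.
  by near: n; apply: filter_forall.
have hn : `|phi (thompson_act h (x n)) - phi (x n)| <= e * phi (x n).
  have n1 : n.+1%:R^-1 < e / i.+1%:R.
    by near: n; exact: (near_infty_natSinv_lt (PosNum ei0)).
  have : n.+1%:R * `|phi (thompson_act h (x n)) - phi (x n)| <= i%:R * phi (x n).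
    by near: n.
  rewrite mulrC -ler_pdivlMr // => /le_trans; apply.
  rewrite mulrAC ler_wpM2r // ltW //.
  apply: (@le_lt_trans _ _ (i.+1%:R / n.+1%:R)).
    by rewrite ler_pM2r ?invr_gt0 // ler_nat.
  by rewrite -ltr_pdivlMl // mulrC.
set G := lamplighter_act _ _.
have GE z : (z \in G) = (z \in D) (+) (z == thompson_act h (x n)).
  rewrite /G /lamplighter_act in_fsymdiff in_fset_act inE /=; congr addb.
  by apply/eqP/eqP => [<-|->]; rewrite ?thompson_actKV ?thompson_actK.
have hxG : thompson_act h (x n) \in G.
  rewrite GE eqxx addbT; apply/negP => hxD.
  by have [+ _] := nD _ hxD; rewrite thompson_actK ltxx.
have G0 : G != fset0 by apply/fset0Pn; exists (thompson_act h (x n)).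
have [[z zG ->] /(_ _ hxG) zh] := min_functionP phi G0.
move: hn; rewrite min_function1 ler_norml => /andP[hn1 hn2].
have -> : 1 - phi z / phi (x n) = (phi (x n) - phi z) / phi (x n).
  by rewrite mulrBl divff // gt_eqF.
rewrite normrM normfV (gtr0_norm (phi_pos (x n))) ler_pdivrMr // ler_norml.
apply/andP; split; first by lra.
move: zG; rewrite GE; have [->|_] := eqVneq z; first by lra.
by rewrite addbF => zD; have [_] := nD z zD; lra.
Unshelve. all: by end_near.
Qed.
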